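(* Let $(\mathcal D,\mathcal I,i^\star)$ be an identification task with $K$ arms and $H:\mathcal D\to\mathbb R^+$ a function. Let $\mu,\lambda^{(1)},\dots,\lambda^{(K)}\in\mathcal D$ be such that for all $j\in[K]$, $i^\star(\lambda^{(j)})\ne i^\star(\mu)$, $H(\lambda^{(j)})>0$, and $\lambda^{(j)}$ differs from $\mu$ only along coordinate $j$. Then for every algorithm family $\mathcal A$ such that $\lim_{T\to+\infty}p_{\mu,T}(\mathcal A)=0$, $$\sup_{j\in[K]}R_{H,\infty}(\mathcal A,\lambda^{(j)})\ge\sum_{j=1}^K\frac{1}{H(\lambda^{(j)})\,\mathrm{KL}(\mu_j,\lambda^{(j)}_j)}.$$
   Context: Setting (fixed budget bandit identification). There are $K\ge 1$ arms. For each arm $k\in[K]=\{1,\dots,K\}$ a one-parameter canonical exponential family of real distributions is fixed; its members are identified with their means, which range over an open interval $\mathcal M_k$. For $x,y\in\mathcal M_k$, $\mathrm{KL}(x,y)$ is the Kullback-Leibler divergence from the member with mean $x$ to the member with mean $y$. A bandit problem is identified with its mean vector $\mu\in\mathcal M_1\times\dots\times\mathcal M_K$. An identification task $(\mathcal D,\mathcal I,i^\star)$ consists of a finite answer set $\mathcal I$, a set $\mathcal D\subseteq\mathcal M_1\times\dots\times\mathcal M_K$, and a function $i^\star:\mathcal D\to\mathcal I$ such that, with $\mathcal D_i=\{\mu\in\mathcal D: i^\star(\mu)=i\}$, each $\mathcal D_i$ is open and equals the interior of its closure, and $\bigcup_{i}\mathrm{cl}(\mathcal D_i)\supseteq\mathcal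 M_1\times\dots\times\mathcal M_K$. An algorithm with horizon $T$: at each time $t=1,\dots,T$ it chooses an arm $k_t$ based on the previous observations and observes an independent sample from the distribution of arm $k_t$; after time $T$ it returns an answer $\hat i_T\in\mathcal I$ based on the observations. The error probability on problem $\mu$ is $p_{\mu,T}(\mathcal A)=\mathbb P_{\mu,\mathcal A}(\hat i_T\ne i^\star(\mu))$. An algorithm family is a sequence $\mathcal A=(\mathcal A_T)_{T\ge1}$ of algorithms, one for each horizon $T$, with $p_{\mu,T}(\mathcal A):=p_{\mu,T}(\mathcal A_T)$. Difficulty ratio: $R_{H,T}(\mathcal A,\mu)=\dfrac{T}{H(\mu)\log(1/p_{\mu,T}(\mathcal A))}\in[0,\infty]$, i.e. $R_{H,T}(\mathcal A,\mu)^{-1}=H(\mu)\log(1/p_{\mu,T}(\mathcal A))/T$, and $R_{H,\infty}(\mathcal A,\mu)=\limsup_{T\to\infty}R_{H,T}(\mathcal A,\mu)$. Conventions: $\log(1/0)=\infty$, $0\cdot\infty=0$, $1/0=\infty$, $1/\infty=0$. *)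

(* Defs.v *)
From HB Require Import structures.
From mathcomp Require Import all_boot all_order all_algebra.
From mathcomp Require Import all_classical all_reals all_analysis.
From mathcomp Require Import measurable_realfun.
Set Implicit Arguments.
Unset Strict Implicit.
Unset Printing Implicit Defensive.
Import Order.TTheory GRing.Theory Num.Theory.
Import numFieldNormedType.Exports.
Local Open Scope classical_set_scope.
Local Open Scope ring_scope.
Local Open Scope charge_scope.
Local Open Scope ereal_scope.

(* One-parameter canonical exponential family of distributions on the real
   line, with natural parameter set [ef_Theta] and log-partition function
   [ef_logpart]. Outside [ef_Theta] the values of [ef_law] are irrelevant.
   Since [ef_Theta] is an open interval and the base measure is not carried by
   a single point, the mean is a continuous strictly increasing function of the
   natural parameter: members are determined by their means and [ef_means]
   below is an open interval. *)
Record exp_family (R : realType) := ExpFamily {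
  ef_base : {sigma_finite_measure set (measurableTypeR R) -> \bar R};
  ef_Theta : set R;
  ef_logpart : R -> R;
  ef_law : R -> probability (measurableTypeR R) R;
  ef_Theta_neq0 : ef_Theta !=set0;
  ef_Theta_open : open ef_Theta;
  ef_Theta_itv : is_interval ef_Theta;
  ef_base_nondegenerate :
    forall c : R, ef_base (~` [set c : measurableTypeR R]) != 0;
  ef_law_density : forall theta, ef_Theta theta ->
    forall B : set (measurableTypeR R), measurable B ->
      ef_law theta B =
      \int[ef_base]_(x in B) (expR (theta * x - ef_logpart theta))%:E
}.

Definition ef_mean (R : realType) (F : exp_family R) (theta : R) : \bar R :=
  \int[ef_law F theta]_x x%:E.

Definition ef_means (R : realType) (F : exp_family R) : set R :=
  [set m | exists2 theta, ef_Theta F theta & ef_mean F theta = m%:E].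

(* The member of mean [m], meaningful for [m] in [ef_means F]. *)
Definition ef_member (R : realType) (F : exp_family R) (m : R) :
    probability (measurableTypeR R) R :=
  ef_law F (get [set theta | ef_Theta F theta /\ ef_mean F theta = m%:E]).

Definition kl_div d (T : measurableType d) (R : realType)
    (P Q : probability T R) : \bar R :=
  if `[< P `<< Q >] then
    \int[P]_x lne (('d (charge_of_finite_measure P) '/d Q) x)
  else +oo.

Definition ef_KL (R : realType) (F : exp_family R) (x y : R) : \bar R :=
  kl_div (ef_member F x) (ef_member F y).

Definition mean_box (R : realType) (K : nat) (fam : 'I_K -> exp_family R) :
    set 'rV[R]_K :=
  [set mu | forall k, ef_means (fam k) (mu ord0 k)].

Definition answer_region (R : realType) (K : nat) (I : finType)
    (D : set 'rV[R]_K) (istar : 'rV[R]_K -> I) (i : I) : set 'rV[R]_K :=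
  [set mu | D mu /\ istar mu = i].

(* [task_ans] is a total function, but only its values on [task_dom] matter. *)
Record id_task (R : realType) (K : nat) (fam : 'I_K -> exp_family R) := IdTask {
  task_answer : finType;
  task_dom : set 'rV[R]_K;
  task_ans : 'rV[R]_K -> task_answer;
  task_dom_sub : task_dom `<=` mean_box fam;
  task_region_open : forall i, open (answer_region task_dom task_ans i);
  task_region_regular : forall i,
    answer_region task_dom task_ans i =
    (closure (answer_region task_dom task_ans i))°;
  task_region_cover : mean_box fam `<=`
    \bigcup_(i in [set: task_answer])
      closure (answer_region task_dom task_ans i)
}.

(* Algorithm with horizon [T], [K] arms and answers in [I]. The internal
   randomness is a seed drawn before the first round, which both the sampling
   rule and the answer may use; a one-point seed space gives the deterministic
   algorithms. [alg_arm t] is the choice of arm after [t] observations; only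
   the indices [t < T] are used. Observations are listed with the most recent
   one first; the past arms need not be listed, as they are functions of the
   seed and of the past observations. *)
Record algorithm (R : realType) (K : nat) (I : finType) (T : nat) := Algorithm {
  alg_disp : measure_display;
  alg_seed : measurableType alg_disp;
  alg_seed_law : probability alg_seed R;
  alg_arm : forall t, alg_seed * t.-tuple (measurableTypeR R) -> 'I_K;
  alg_arm_measurable :
    forall t k, measurable (@alg_arm t @^-1` [set k]);
  alg_answer : alg_seed * T.-tuple (measurableTypeR R) -> I;
  alg_answer_measurable : forall i, measurable (alg_answer @^-1` [set i])
}.

Arguments alg_arm {R K I T} a t w.
Arguments alg_arm_measurable {R K I T} a t k.
Arguments alg_answer {R K I T} a w.
Arguments alg_answer_measurable {R K I T} a i.

Section initial_law.
Context d (S : measurableType d) (R : realType) (P : probability S R).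

Definition seed_history (s : S) : S * 0.-tuple (measurableTypeR R) :=
  (s, [tuple]).

Lemma measurable_seed_history : measurable_fun setT seed_history.
Proof. by apply: measurable_fun_pair. Qed.

HB.instance Definition _ := @isMeasurableFun.Build _ _ _ _ seed_history
  measurable_seed_history.

Definition initial_law : probability (S * 0.-tuple (measurableTypeR R))%type R :=
  distribution P seed_history.

End initial_law.

(* [next_law P a] is the law of (seed, observations) after one more round, when
   it is [P] before that round and the arm is chosen by the rule [a]: given
   the past [w], the new observation has law [nu (a w)]. *)
Section next_law.
Context d (S : measurableType d) (R : realType) (K t : nat).
Local Notation history := (S * t.-tuple (measurableTypeR R))%type.
Local Notation history' := (S * t.+1.-tuple (measurableTypeR R))%type.
Variables (nu : 'I_K -> probability (measurableTypeR R) R)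
  (P : probability history R) (a : history -> 'I_K).
Hypothesis ma : forall k, measurable (a @^-1` [set k]).

Definition add_obs (w : history) (x : measurableTypeR R) : history' :=
  (w.1, [tuple of x :: w.2]).

Definition next_law_fun (_ : forall k, measurable (a @^-1` [set k]))
    (B : set history') : \bar R :=
  \int[P]_w nu (a w) (add_obs w @^-1` B).

Lemma measurable_add_obs :
  measurable_fun setT (fun wx : history * measurableTypeR R => add_obs wx.1 wx.2).
Proof.
apply: measurable_fun_pair.
  exact: measurableT_comp measurable_fst measurable_fst.
apply: measurable_cons => //.
exact: measurableT_comp measurable_snd measurable_fst.
Qed.

Lemma measurable_add_obs_preimage w (B : set history') : measurable B ->
  measurable (add_obs w @^-1` B).
Proof.
move=> mB; rewrite -[X in measurable X]setTI.
have -> : add_obs w = (fun wx => add_obs wx.1 wx.2) \o (pair w) by [].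
apply: (measurableT_comp measurable_add_obs) => //.
Qed.

Let ker (w : history) : {measure set (measurableTypeR R) -> \bar R} := nu (a w).

Let measurable_ker U : measurable U -> measurable_fun [set: history] (ker ^~ U).
Proof.
move=> mU _ Y mY; rewrite setTI.
rewrite (_ : _ @^-1` _ =
    \bigcup_(k in [set k | Y (nu k U)]) (a @^-1` [set k])).
  apply: fin_bigcup_measurable; first exact: finite_finset.
  by move=> k _; exact: ma.
apply/seteqP; split=> [w Yw|w [k Yk /= ak]] /=; first by exists (a w).
by rewrite /ker ak.
Qed.

HB.instance Definition _ := isKernel.Build _ _ _ _ _ ker measurable_ker.

Let ker_setT w : ker w setT = 1.
Proof. exact: probability_setT. Qed.

HB.instance Definition _ := Kernel_isProbability.Build _ _ _ _ _ ker ker_setT.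

Lemma measurable_next_law_integrand (B : set history') : measurable B ->
  measurable_fun setT (fun w => nu (a w) (add_obs w @^-1` B)).
Proof.
move=> mB.
pose B' := (fun wx => add_obs wx.1 wx.2) @^-1` B.
have mB' : measurable B'.
  by rewrite -[X in measurable X]setTI; exact: measurable_add_obs.
have -> : (fun w => nu (a w) (add_obs w @^-1` B)) =
    (fun w => ker w (xsection B' w)).
  by apply/funext => w; rewrite xsectionE.
by apply: measurable_fun_xsection_finite_kernel; rewrite inE.
Qed.

Let next_law0 : next_law_fun ma set0 = 0.
Proof.
by apply: integral0_eq => w _; rewrite preimage_set0 measure0.
Qed.

Let next_law_ge0 B : 0 <= next_law_fun ma B.
Proof. exact: integral_ge0. Qed.

Let next_law_sigma_additive : semi_sigma_additive (next_law_fun ma).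
Proof.
move=> F mF tF mUF.
rewrite [X in _ --> X](_ : _ = \sum_(n <oo) next_law_fun ma (F n)).
  by apply: is_cvg_ereal_nneg_natsum => n _; exact: next_law_ge0.
rewrite -integral_nneseries //; last first.
  by move=> n; exact: measurable_next_law_integrand.
apply: eq_integral => w _; rewrite preimage_bigcup measure_bigcup//.
- by apply: eq_eseriesl => n; rewrite in_setT.
- by move=> n _; exact: measurable_add_obs_preimage.
- apply/trivIsetP => i j _ _ ij; rewrite -preimage_setI.
  by move/trivIsetP : tF => ->//; rewrite preimage_set0.
Qed.

HB.instance Definition _ := isMeasure.Build _ _ _ (next_law_fun ma)
  next_law0 next_law_ge0 next_law_sigma_additive.

Let next_law_setT : next_law_fun ma setT = 1.
Proof.
rewrite /next_law_fun (eq_integral (cst 1)) => [|w _].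
  by rewrite integral_cst// mul1e; exact: probability_setT.
exact: probability_setT.
Qed.

HB.instance Definition _ :=
  Measure_isProbability.Build _ _ _ (next_law_fun ma) next_law_setT.

Definition next_law : probability history' R := next_law_fun ma.

End next_law.

(* Law of the seed and of the first [t] observations. *)
Fixpoint history_law (R : realType) (K : nat) (I : finType) (T : nat)
    (A : algorithm R K I T) (nu : 'I_K -> probability (measurableTypeR R) R)
    (t : nat) :
    probability (alg_seed A * t.-tuple (measurableTypeR R))%type R :=
  match t with
  | 0%N => initial_law (alg_seed_law A)
  | t'.+1 => next_law nu (history_law A nu t') (alg_arm_measurable A t')
  end.

Definition bandit (R : realType) (K : nat) (fam : 'I_K -> exp_family R)
    (mu : 'rV[R]_K) (k : 'I_K) : probability (measurableTypeR R) R :=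
  ef_member (fam k) (mu ord0 k).

Definition error_prob (R : realType) (K : nat) (fam : 'I_K -> exp_family R)
    (task : id_task fam) (T : nat) (A : algorithm R K (task_answer task) T)
    (mu : 'rV[R]_K) : \bar R :=
  history_law A (bandit fam mu) T [set w | alg_answer A w <> task_ans task mu].

(* Here [lne 0^-1 = +oo], [0 * +oo = 0], [0^-1 = +oo] and [(+oo)^-1 = 0]. *)
Definition difficulty_ratio (R : realType) (K : nat) (fam : 'I_K -> exp_family R)
    (task : id_task fam) (H : 'rV[R]_K -> R) (T : nat)
    (A : algorithm R K (task_answer task) T) (mu : 'rV[R]_K) : \bar R :=
  (T%:R)%:E / ((H mu)%:E * lne (error_prob A mu)^-1).

(* The term of index [T = 0] does not affect the limit superior. *)
Definition difficulty_limsup (R : realType) (K : nat)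
    (fam : 'I_K -> exp_family R) (task : id_task fam) (H : 'rV[R]_K -> R)
    (A : forall T, algorithm R K (task_answer task) T) (mu : 'rV[R]_K) : \bar R :=
  limn_esup (fun T => difficulty_ratio H (A T) mu).

(* Main.v *)
(* Let N_j be the expected number of pulls of arm j under mu. Since lambda^(j)
   differs from mu only in arm j, the laws of the T observations under mu and
   lambda^(j) have divergence at most KL_j N_j, where KL_j = KL(mu_j,
   lambda^(j)_j). This is proved in Donsker-Varadhan form,
     E_mu f <= KL_j N_j + log E_lambda(j) (exp f)   for bounded f >= 0,
   by removing one observation at a time, so no likelihood ratio of histories
   is needed. For f = x 1_E, with E the event that the answer is the correct
   one for mu and 0 <= x <= log (1 / p_{lambda^(j),T}), it gives
     x P_mu(E) <= KL_j N_j + log 2.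
   If all the difficulty ratios were eventually below some s, the choice
   x = T / (s H(lambda^(j))) would be allowed; dividing by KL_j, summing
   over j with sum_j N_j = T and letting T tend to infinity, where P_mu(E)
   tends to 1, gives sum_j 1 / (H(lambda^(j)) KL_j) <= s. *)
Require Import Defs.
From mathcomp Require Import all_boot all_order all_algebra.
From mathcomp Require Import all_classical all_reals all_analysis.
From mathcomp Require Import measurable_realfun giry.
From mathcomp Require Import ring lra.
Set Implicit Arguments.
Unset Strict Implicit.
Unset Printing Implicit Defensive.
Import Order.TTheory GRing.Theory Num.Theory.
Import numFieldNormedType.Exports.
Local Open Scope classical_set_scope.
Local Open Scope ring_scope.
Local Open Scope charge_scope.
Local Open Scope ereal_scope.

(** * Integration against the law of the history after one more round *)

Section next_law_integral.
Context d (S : measurableType d) (R : realType) (K t : nat).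
Local Notation history := (S * t.-tuple (measurableTypeR R))%type.
Local Notation history' := (S * t.+1.-tuple (measurableTypeR R))%type.
Variables (nu : 'I_K -> probability (measurableTypeR R) R)
  (P : probability history R) (a : history -> 'I_K).
Hypothesis ma : forall k, measurable (a @^-1` [set k]).

Lemma measurable_add_obsr (w : history) : measurable_fun setT (add_obs w).
Proof.
by move=> _ B mB; rewrite setTI; exact: measurable_add_obs_preimage.
Qed.

(** The conditional law of the extended history given the past [w], as a point of the space of
    measures, so that [next_law] can be compared with a Giry bind. *)
Definition obs_kernel (w : history) : giry history' R :=
  giry_map (measurable_add_obsr w) (nu (a w)).

Lemma measurable_obs_kernel : measurable_fun setT obs_kernel.
Proof.
apply: measurable_giry_codensity => // B mB.
exact: measurable_next_law_integrand.
Qed.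

Variable f : history' -> \bar R.
Hypotheses (mf : measurable_fun [set: history'] f) (f0 : forall w, 0 <= f w).

Lemma measurable_integral_obs :
  measurable_fun [set: history] (fun w => \int[nu (a w)]_x f (add_obs w x)).
Proof.
rewrite [X in measurable_fun _ X](_ : _ = giry_int ^~ f \o obs_kernel).
  apply: (@measurableT_comp _ _ _ _ _ _ (giry_int ^~ f)).
    exact: measurable_giry_int.
  exact: measurable_obs_kernel.
by apply/funext => w /=; rewrite /obs_kernel giry_int_map.
Qed.

(** On measurable sets [next_law] agrees with the bind of [P] along [obs_kernel], so the
    iterated-integral formula for a bind carries over. *)
Lemma integral_next_law :
  \int[next_law nu P ma]_w f w =
  \int[P]_w \int[nu (a w)]_x f (add_obs w x).
Proof.
transitivity (giry_int (giry_bind P measurable_obs_kernel) f).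
  apply: eq_measure_integral => B mB _.
  rewrite /giry_bind /=.
  transitivity (giry_int (giry_map measurable_obs_kernel P) (giry_ev ^~ B)).
    rewrite giry_int_map//; exact: measurable_giry_ev.
  by [].
rewrite giry_int_bind//; apply: eq_integral => w _.
by rewrite giry_int_map.
Qed.

End next_law_integral.

(** * Measures given by an explicit density *)

Section density.
Context d (T : measurableType d) (R : realType).
Variables (nu : {finite_measure set T -> \bar R})
  (mu : {sigma_finite_measure set T -> \bar R}) (g : T -> \bar R).
Hypotheses (mg : measurable_fun setT g)
  (nug : forall B, measurable B -> nu B = \int[mu]_(x in B) g x).

Lemma density_dominates : nu `<< mu.
Proof.
apply/null_content_dominatesP => B mB muB0; rewrite nug//.
by apply: null_set_integral => //; exact: measurable_funTS.
Qed.

(** The Radon-Nikodym derivative and [g] have the same integral over every measurable set, hence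
    agree [mu]-almost everywhere, and the change of variables for the former gives the one for
    [g]. *)
Lemma integral_density f : measurable_fun setT f -> (forall x, 0 <= f x) ->
  \int[nu]_x f x = \int[mu]_x (f x * g x).
Proof.
move=> mf f0.
rewrite -(Radon_Nikodym_SigmaFinite.change_of_variables density_dominates)//.
apply: ae_eq_integral => //.
- apply: emeasurable_funM => //; apply: measurable_int.
  exact: Radon_Nikodym_SigmaFinite.f_integrable density_dominates.
- exact: emeasurable_funM.
- apply: ae_eqe_mul2l; apply: integral_ae_eq => //.
    exact: Radon_Nikodym_SigmaFinite.f_integrable density_dominates.
  move=> B _ mB; rewrite -nug//.
  by rewrite -(Radon_Nikodym_SigmaFinite.f_integral density_dominates).
Qed.

(** The same comparison for the derivative of charges, which is the one appearing in [kl_div]. *)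
Lemma ae_eq_density :
  ae_eq mu setT ('d (charge_of_finite_measure nu) '/d mu) g.
Proof.
apply: integral_ae_eq => //.
  by apply: Radon_Nikodym_integrable; exact: density_dominates.
move=> B _ mB; rewrite -nug// -Radon_Nikodym_integral//.
exact: density_dominates.
Qed.

End density.

(** * Divergence bounds in Donsker-Varadhan form *)

Section donsker_varadhan.
Context d (T : measurableType d) (R : realType).
Implicit Types (P Q : probability T R) (f : T -> R).

Lemma probability_integral_cst P (r : R) : \int[P]_x r%:E = r%:E.
Proof. by rewrite integral_cst// [X in _ * X]probability_setT mule1. Qed.

Lemma probability_integral_bounds P f (a b : R) : measurable_fun setT f ->
  (0 <= a)%R -> (forall x, a <= f x <= b)%R ->
  a%:E <= \int[P]_x (f x)%:E <= b%:E.
Proof.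
move=> mf a0 fab.
have f0 x : (0 <= f x)%R by have /andP[/(le_trans a0)] := fab x.
have b0 : (0 <= b)%R.
  by have /andP[_] := fab point; exact/le_trans.
rewrite -(probability_integral_cst P a) -(probability_integral_cst P b).
apply/andP; split; apply: ge0_le_integral => //.
- exact/measurable_EFinP.
- by move=> x _; rewrite lee_fin; have /andP[] := fab x.
- by move=> x _; rewrite lee_fin.
- exact/measurable_EFinP.
- by move=> x _; rewrite lee_fin; have /andP[] := fab x.
Qed.

Lemma integral_expR_bounds Q f (c : R) : measurable_fun setT f ->
  (forall x, 0 <= f x <= c)%R ->
  1 <= \int[Q]_x (expR (f x))%:E <= (expR c)%:E.
Proof.
move=> mf fc; apply: probability_integral_bounds => // [|x].
  exact: measurableT_comp.
by rewrite -[X in (X <= _ <= _)%R]expR0 !ler_expR.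
Qed.

(* The Donsker-Varadhan form of KL(P, Q) <= k. Bounded nonnegative test
   functions are enough here and keep all the integrals in the extended reals
   well defined. *)
Definition kl_le P Q (k : R) := forall f (c : R), measurable_fun setT f ->
  (forall x, 0 <= f x <= c)%R ->
  \int[P]_x (f x)%:E <= k%:E + lne (\int[Q]_x (expR (f x))%:E).

(** Changing measure turns the integral of [expR f] under [Q] into that of [expR (f - l)] under [P];
    by Jensen's inequality it is at least the exponential of the mean of [f - l], which is the mean
    of [f] minus [k]. *)
Lemma kl_le_density P Q (l : T -> R) (k : R) :
  P.-integrable setT (EFin \o l) -> \int[P]_x (l x)%:E = k%:E ->
  (forall B, measurable B -> P B = \int[Q]_(x in B) (expR (l x))%:E) ->
  kl_le P Q k.
Proof.
move=> il lk PQ f c mf fc.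
have ml : measurable_fun setT l by exact/measurable_EFinP/(measurable_int _ il).
have mexpl : measurable_fun setT (fun x => (expR (l x))%:E).
  by apply/measurable_EFinP; exact: measurableT_comp.
have expl0 x : 0 <= (expR (l x))%:E by rewrite lee_fin expR_ge0.
have /andP[Pf0 Pfc] := @probability_integral_bounds P f 0%R c mf (lexx _) fc.
have : \int[P]_x (f x)%:E \is a fin_num.
  by rewrite ge0_fin_numE// (le_lt_trans Pfc)// ltry.
move=> /fineK; move: (fine _) => F fF; rewrite -fF.
have intf : P.-integrable setT (EFin \o f).
  apply/integrableP; split; first exact/measurable_EFinP.
  under eq_integral.
    move=> x _; rewrite /= ger0_norm; last by have /andP[] := fc x.
    over.
  by rewrite -fF ltry.
have mfl : measurable_fun setT (fun x => (expR (f x - l x))%:E).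
  apply/measurable_EFinP; apply: measurableT_comp => //.
  exact: measurable_funB.
have QP : \int[Q]_x (expR (f x))%:E = \int[P]_x (expR (f x - l x))%:E.
  rewrite (integral_density mexpl PQ)//.
  by apply: eq_integral => x _; rewrite -EFinM -expRD subrK.
have /andP[Q1 Qc] := @integral_expR_bounds Q f c mf fc.
have intfl : P.-integrable setT (fun x => (expR (f x - l x))%:E).
  apply/integrableP; split => //.
  under eq_integral do rewrite gee0_abs ?lee_fin ?expR_ge0//.
  by rewrite -QP (le_lt_trans Qc)// ltry.
have intB : P.-integrable setT (fun x => (f x)%:E - (l x)%:E).
  exact: (integrableB _ intf il).
pose m := (F - k)%R.
have intD : P.-integrable setT
    (fun x => (1 - m)%:E + ((f x)%:E - (l x)%:E)).
  apply: integrableD => //; exact: finite_measure_integrable_cst.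
(* Jensen's inequality by integrating the tangent line of [expR] at [m], the mean of [f - l] under
   [P]: [expR m * (1 - m + u) <= expR u] with [u = f x - l x]. *)
have jensen : (expR m)%:E <= \int[Q]_x (expR (f x))%:E.
  rewrite QP.
  have -> : (expR m)%:E = \int[P]_x ((expR m)%:E *
      ((1 - m)%:E + ((f x)%:E - (l x)%:E))).
    rewrite integralZl// integralD//; last exact: finite_measure_integrable_cst.
    rewrite probability_integral_cst.
    rewrite (integralB measurableT intf il) /= -fF lk -EFinB -EFinD -EFinM.
    by congr (_%:E); rewrite /m; ring.
  apply: le_integral => //; first exact: integrableZl.
  move=> x _; rewrite -EFinB -EFinD -EFinM lee_fin.
  have -> : (expR (f x - l x) = expR m * expR (f x - l x - m))%R.
    by rewrite -expRD; congr expR; ring.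
  rewrite ler_pM2l ?expR_gt0//.
  have := expR_ge1Dx (f x - l x - m); apply: le_trans.
  by rewrite le_eqVlt; apply/orP; left; apply/eqP; rewrite /m; ring.
have : lne (expR m)%:E <= lne (\int[Q]_x (expR (f x))%:E).
  rewrite lee_lne// in_itv /= leey andbT ?lee_fin ?expR_ge0//.
  exact: le_trans Q1.
rewrite lne_EFin ?expR_gt0// expRK => mQ.
have -> : F%:E = k%:E + m%:E by rewrite -EFinD /m addrC subrK.
by rewrite leeD2l.
Qed.

Lemma kl_le_refl P : kl_le P P 0.
Proof.
apply: (@kl_le_density _ _ (cst 0%R)) => [||B mB].
- exact: finite_measure_integrable_cst.
- by rewrite integral0.
- under eq_integral do rewrite /= expR0.
  by rewrite integral_cst// mul1e.
Qed.

End donsker_varadhan.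

(** * Chain rule for one more observation *)

Lemma measurable_comp_finite d (T : measurableType d) d' (U : measurableType d')
    (J : finType) (a : T -> J) (h : J -> U) :
  (forall j, measurable (a @^-1` [set j])) -> measurable_fun setT (h \o a).
Proof.
move=> ma _ Y mY; rewrite setTI.
rewrite (_ : _ @^-1` _ = \bigcup_(j in [set j | Y (h j)]) (a @^-1` [set j])).
  by apply: fin_bigcup_measurable => //; exact: finite_finset.
by apply/seteqP; split=> [w Yw|w [j /= Yj awj]]; [exists (a w)|rewrite /= awj].
Qed.

Lemma kl_le_next_law d (S : measurableType d) (R : realType) (K t : nat)
    (nu nu' : 'I_K -> probability (measurableTypeR R) R)
    (P Q : probability (S * t.-tuple (measurableTypeR R))%type R)
    (a : S * t.-tuple (measurableTypeR R) -> 'I_K)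
    (ma : forall k, measurable (a @^-1` [set k])) (k : R) (kl : 'I_K -> R) :
  (forall i, 0 <= kl i)%R -> (forall i, kl_le (nu i) (nu' i) (kl i)) ->
  kl_le P Q k ->
  kl_le (next_law nu P ma) (next_law nu' Q ma)
    (k + fine (\int[P]_w (kl (a w))%:E)).
Proof.
move=> kl0 klnu PQ f c mf fc.
have f0 x : 0 <= (f x)%:E by rewrite lee_fin; have /andP[] := fc x.
have mfE : measurable_fun setT (fun x => (f x)%:E) by exact/measurable_EFinP.
have mef : measurable_fun setT (fun x => (expR (f x))%:E).
  by apply/measurable_EFinP; exact: measurableT_comp.
have ef0 x : 0 <= (expR (f x))%:E by rewrite lee_fin expR_ge0.
rewrite (integral_next_law nu P ma mfE f0) (integral_next_law nu' Q ma mef ef0).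
have mfw w : measurable_fun setT (fun x => f (add_obs w x)).
  exact: measurableT_comp mf (measurable_add_obsr w).
have bnd w := integral_expR_bounds (nu' (a w)) (mfw w)
  (fun x => fc (add_obs w x)).
(* Integrating out the last observation turns [f] into the test function
   [g w = ln E[expR f | w]] on the shorter histories. *)
pose G w := \int[nu' (a w)]_x (expR (f (add_obs w x)))%:E.
have G_fin w : G w \is a fin_num.
  have /andP[G1 Gc] := bnd w.
  by rewrite ge0_fin_numE ?(le_trans _ G1)// (le_lt_trans Gc)// ltry.
have G1 w : (1 <= fine (G w))%R.
  by have /andP[G1 _] := bnd w; rewrite -lee_fin fineK.
have Gc w : (fine (G w) <= expR c)%R.
  by have /andP[_ Gc] := bnd w; rewrite -lee_fin fineK.
pose g w := ln (fine (G w)).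
have gE w : expR (g w) = fine (G w).
  by rewrite lnK// posrE (lt_le_trans _ (G1 w)).
have mg : measurable_fun setT g.
  have mG := measurable_integral_obs nu' ma mef ef0.
  apply: measurableT_comp => //.
  by apply: (@measurableT_comp _ _ _ _ _ _ fine).
have gc w : (0 <= g w <= c)%R.
  by apply/andP; split; rewrite -ler_expR gE ?expR0.
have mkl : measurable_fun setT (fun w => (kl (a w))%:E).
  by apply/measurable_EFinP; exact: (measurable_comp_finite kl ma).
have kl_fin : \int[P]_w (kl (a w))%:E \is a fin_num.
  have klb w : (0 <= kl (a w) <= \sum_i kl i)%R.
    by rewrite kl0 /= (bigD1 (a w))//= lerDl sumr_ge0.
  have /andP[i0 i1] := probability_integral_bounds P
    (measurable_comp_finite kl ma) (lexx _) klb.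
  by rewrite ge0_fin_numE// (le_lt_trans i1)// ltry.
have mfw_int := measurable_integral_obs nu ma mfE f0.
(* Given [w], both laws draw the new observation from the same arm [a w], so the bound for that arm
   applies inside the integral over [w]. *)
have step : \int[P]_w \int[nu (a w)]_x (f (add_obs w x))%:E <=
    \int[P]_w ((kl (a w))%:E + (g w)%:E).
  apply: ge0_le_integral => //.
  - by move=> w _; exact: integral_ge0.
  - apply: emeasurable_funD => //; exact/measurable_EFinP.
  - move=> w _; have := klnu (a w) _ c (mfw w) (fun x => fc (add_obs w x)).
    by rewrite -/(G w) -(fineK (G_fin w)) lne_EFin// (lt_le_trans _ (G1 w)).
apply: (le_trans step); rewrite ge0_integralD//; last 3 first.
- by move=> w _; rewrite lee_fin.
- by move=> w _; rewrite lee_fin; have /andP[] := gc w.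
- exact/measurable_EFinP.
(* Since [expR g] is [G], the logarithmic term for [f] on the longer histories is the one for [g] on
   the shorter ones, and the bound between [P] and [Q] applies to [g]. *)
have <- : \int[Q]_w (expR (g w))%:E = \int[Q]_w G w.
  by apply: eq_integral => w _; rewrite gE fineK.
have PQg := PQ g c mg gc.
rewrite EFinD (fineK kl_fin) [k%:E + _]addeC -[leRHS]addeA.
exact: leeD2l.
Qed.

(** * Expected numbers of pulls and the divergence between histories *)

Section pulls.
Context (R : realType) (K : nat) (I : finType) (T : nat).
Variables (A : algorithm R K I T).
Implicit Types nu : 'I_K -> probability (measurableTypeR R) R.

Lemma kl_le_history nu nu' (kl : 'I_K -> R) :
  (forall i, 0 <= kl i)%R -> (forall i, kl_le (nu i) (nu' i) (kl i)) ->
  forall t, kl_le (history_law A nu t) (history_law A nu' t)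
    (\sum_(s < t) fine (\int[history_law A nu s]_w (kl (alg_arm A s w))%:E)).
Proof.
move=> kl0 klnu; elim=> [|t IHt]; first by rewrite big_ord0; exact: kl_le_refl.
by rewrite big_ord_recr /=; exact: kl_le_next_law.
Qed.

Definition expected_pulls nu (j : 'I_K) : R :=
  \sum_(s < T)
    fine (\int[history_law A nu s]_w ((alg_arm A s w == j)%:R)%:E).

Lemma measurable_is_arm s j :
  measurable_fun setT (fun w => (alg_arm A s w == j)%:R : R).
Proof.
exact: (measurable_comp_finite (fun k => (k == j)%:R : R)
  (alg_arm_measurable A s)).
Qed.

Lemma fin_num_is_arm nu s j :
  \int[history_law A nu s]_w ((alg_arm A s w == j)%:R)%:E \is a fin_num.
Proof.
have b01 w : ((0 : R) <= (alg_arm A s w == j)%:R <= (1 : R))%R.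
  by rewrite ler0n lern1 leq_b1.
have /andP[i0 i1] := probability_integral_bounds (history_law A nu s)
  (measurable_is_arm j) (lexx _) b01.
by rewrite ge0_fin_numE// (le_lt_trans i1)// ltry.
Qed.

(** In each of the [T] rounds exactly one arm is chosen, so the indicators over the arms add up to
    1. *)
Lemma sum_expected_pulls nu : (\sum_j expected_pulls nu j = T%:R)%R.
Proof.
rewrite exchange_big /=.
rewrite (eq_bigr (fun=> 1%R)); first by rewrite big_const_ord iter_addr_0.
move=> s _; apply: EFin_inj; rewrite -sumEFin.
under eq_bigr do rewrite fineK ?fin_num_is_arm//.
rewrite -ge0_integral_sum//; last first.
  by move=> j; apply/measurable_EFinP; exact: measurable_is_arm.
rewrite -[RHS](probability_integral_cst (history_law A nu s)).
apply: eq_integral => w _; rewrite sumEFin; congr (_%:E).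
rewrite (bigD1 (alg_arm A s w))//= eqxx big1 ?addr0// => j.
by rewrite eq_sym => /negbTE ->.
Qed.

(** Arms with equal laws admit the bound 0, so the sum over rounds only retains the pulls of arm
    [j], each costing [k]. *)
Lemma kl_le_one_arm nu nu' (j : 'I_K) (k : R) : (0 <= k)%R ->
  (forall i, i != j -> nu i = nu' i) -> kl_le (nu j) (nu' j) k ->
  kl_le (history_law A nu T) (history_law A nu' T) (k * expected_pulls nu j).
Proof.
move=> k0 nunu' klj.
have := @kl_le_history nu nu' (fun i => k * (i == j)%:R)%R.
rewrite (_ : k * expected_pulls nu j = \sum_(s < T)
  fine (\int[history_law A nu s]_w (k * (alg_arm A s w == j)%:R)%:E))%R.
  apply => i; first by rewrite mulr_ge0.
  have [->|ij] := eqVneq i j; first by rewrite mulr1.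
  by rewrite mulr0 nunu'//; exact: kl_le_refl.
rewrite mulr_sumr; apply: eq_bigr => s _.
under [in RHS]eq_integral do rewrite EFinM.
rewrite ge0_integralZl//; first by rewrite fineM ?fin_num_is_arm.
by apply/measurable_EFinP; exact: measurable_is_arm.
Qed.

End pulls.

(** * Divergence bounds for events, and the divergence of an explicit density *)

Lemma kl_le_event d (T : measurableType d) (R : realType)
    (P Q : probability T R) (k : R) (E : set T) (x : R) :
  kl_le P Q k -> measurable E -> (0 <= x)%R ->
  (expR x)%:E * Q E <= 1 -> (x * fine (P E) <= k + ln 2)%R.
Proof.
move=> PQ mE x0 xQ.
have mxE : measurable_fun setT (fun w => x * \1_E w : R)%R.
  by apply: measurable_funM => //; exact: measurable_indic.
have xb w : (0 <= x * \1_E w <= x)%R.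
  rewrite indicE mulr_ge0//=; case: (w \in E); first by rewrite mulr1.
  by rewrite mulr0.
have mI : measurable_fun setT (fun w => (\1_E w)%:E : \bar R).
  by apply/measurable_EFinP; exact: measurable_indic.
have /andP[e1 _] := integral_expR_bounds Q mxE xb.
have := PQ _ _ mxE xb.
under eq_integral do rewrite EFinM.
rewrite ge0_integralZl ?lee_fin// integral_indic// setIT.
rewrite -lee_fin EFinM fineK ?fin_num_measure// => /le_trans; apply.
rewrite EFinD leeD2l// -lne_EFin// lee_lne ?in_itv /= ?leey ?andbT.
(* Pointwise [expR (x * \1_E) <= 1 + expR x * \1_E], and the right side has integral at most 2 by
   the assumption on [Q E]; this is the origin of [ln 2]. *)
- apply: (@le_trans _ _ (\int[Q]_w (1 + (expR x)%:E * (\1_E w)%:E))).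
    apply: ge0_le_integral => //.
    + by apply/measurable_EFinP; exact: measurableT_comp.
    + apply: emeasurable_funD => //; exact: measurable_funeM.
    + move=> w _; rewrite indicE; case: (w \in E).
        by rewrite mulr1 mule1 leeDr.
      by rewrite mulr0 mule0 adde0 expR0.
  rewrite ge0_integralD//; last exact: measurable_funeM.
  rewrite probability_integral_cst ge0_integralZl//.
  rewrite integral_indic// setIT (_ : 2%:E = 1 + 1)//.
  exact: leeD2l.
- exact: le_trans e1.
- by rewrite lee_fin.
Qed.

(** With the zero test function both the left side and the logarithmic term vanish. *)
Lemma kl_le_ge0 d (T : measurableType d) (R : realType)
    (P Q : probability T R) (k : R) : kl_le P Q k -> (0 <= k)%R.
Proof.
move=> PQ.
have := PQ (fun=> 0%R) 0%R (measurable_cst _) (fun=> _).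
under [X in lne X]eq_integral do rewrite expR0.
rewrite !probability_integral_cst lne1 adde0 lee_fin.
by apply => x; rewrite lexx.
Qed.

(** The derivative equals [expR l] almost everywhere for [Q], hence also for [P], which [Q]
    dominates; its logarithm is then [l]. *)
Lemma kl_div_density d (T : measurableType d) (R : realType)
    (P Q : probability T R) (l : T -> R) :
  measurable_fun setT l ->
  (forall B, measurable B -> P B = \int[Q]_(x in B) (expR (l x))%:E) ->
  kl_div P Q = \int[P]_x (l x)%:E.
Proof.
move=> ml PQ.
have mexpl : measurable_fun setT (fun x => (expR (l x))%:E).
  by apply/measurable_EFinP; exact: measurableT_comp.
have PdQ : P `<< Q by exact: density_dominates mexpl PQ.
rewrite /kl_div asboolT//; set RN := 'd _ '/d _.
apply: ae_eq_integral => //.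
- have mRN : measurable_fun setT (fun x => fine (RN x)).
    apply: (@measurableT_comp _ _ _ _ _ _ fine) => //.
    have : Q.-integrable setT RN by exact: Radon_Nikodym_integrable.
    exact: measurable_int.
  (* The derivative is finite everywhere, so measurability only concerns the values of [lne] at
     finite arguments. *)
  rewrite (_ : (fun x => _) = (fun x => if (fine (RN x) <= 0)%R then -oo
      else (ln (fine (RN x)))%:E)).
    apply: measurable_fun_ifT => //; first exact: measurable_fun_ler.
    by apply/measurable_EFinP; exact: measurableT_comp.
  apply/funext => x.
  have /fineK {1}<- // : RN x \is a fin_num by exact: Radon_Nikodym_fin_num.
- exact/measurable_EFinP.
- have /(null_dominates_ae_eq measurableT PdQ) :=
    ae_eq_density mexpl PQ.
  apply: filterS => x /[apply]; rewrite -/RN => ->.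
  by rewrite lne_EFin ?expR_gt0// expRK.
Qed.

(** * Divergences inside an exponential family *)

Section exp_family.
Context (R : realType) (F : exp_family R).

(** The log-likelihood ratio at [x] of natural parameter [s] against [t]. *)
Definition ef_llr (s t x : R) : R :=
  ((s * x - ef_logpart F s) - (t * x - ef_logpart F t))%R.

Lemma measurable_ef_exponent (s : R) :
  measurable_fun [set: measurableTypeR R] (fun x => s * x - ef_logpart F s)%R.
Proof.
apply: measurable_funB => //; exact: measurable_funM.
Qed.

Lemma ef_law_change (s t : R) : ef_Theta F s -> ef_Theta F t ->
  forall B, measurable B ->
  ef_law F s B = \int[ef_law F t]_(x in B) (expR (ef_llr s t x))%:E.
Proof.
move=> Fs Ft B mB; rewrite (ef_law_density Fs)// [RHS]integral_mkcond.
have mexp u : measurable_fun [set: measurableTypeR R]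
    (fun x => (expR (u * x - ef_logpart F u))%:E).
  apply/measurable_EFinP; apply: measurableT_comp => //.
  exact: measurable_ef_exponent.
rewrite (integral_density (mexp t) (ef_law_density Ft)).
- rewrite [LHS]integral_mkcond; apply: eq_integral => x _ /=.
  rewrite !patchE; case: ifPn => _; last by rewrite mul0e.
  by rewrite -EFinM -expRD subrK.
- apply/(measurable_restrictT _ mB); apply/measurable_EFinP.
  apply: measurableT_comp => //; apply: measurable_funTS.
  by apply: measurable_funB; exact: measurable_ef_exponent.
- by move=> x; apply: erestrict_ge0 => y _; rewrite lee_fin expR_ge0.
Qed.

(** The log-likelihood ratio is affine in the observation, so a finite mean makes it integrable; its
    mean is the divergence, and [kl_le_density] applies. *)
Lemma ef_KLP (x y : R) : ef_means F x -> ef_means F y ->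
  exists2 k : R, ef_KL F x y = k%:E &
    kl_le (ef_member F x) (ef_member F y) k.
Proof.
move=> [s0 Fs0 xs0] [t0 Ft0 yt0]; rewrite /ef_KL /ef_member.
have /getPex[] : exists s, [set s | ef_Theta F s /\ ef_mean F s = x%:E] s.
  by exists s0.
have /getPex[] : exists t, [set t | ef_Theta F t /\ ef_mean F t = y%:E] t.
  by exists t0.
move: (get _) => t Ft _; move: (get _) => s Fs xs.
have ml : measurable_fun [set: measurableTypeR R] (ef_llr s t).
  by apply: measurable_funB; exact: measurable_ef_exponent.
have ix : (ef_law F s).-integrable [set: measurableTypeR R] EFin.
  have mE : measurable_fun [set: measurableTypeR R] (EFin : R -> \bar R).
    exact/measurable_EFinP.
  (* A finite value of the extended integral already forces absolute integrability. *)
  apply/integrableP; split => //; apply/(abse_integralP _ measurableT mE).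
  by have := xs; rewrite /ef_mean => ->; rewrite ltry.
have il : (ef_law F s).-integrable setT (EFin \o ef_llr s t).
  have -> : EFin \o ef_llr s t = (fun z => ((s - t)%R%:E * z%:E +
      (ef_logpart F t - ef_logpart F s)%R%:E)).
    by apply/funext => z /=; rewrite -EFinM -EFinD /ef_llr; congr (_%:E); ring.
  apply: integrableD => //; last exact: finite_measure_integrable_cst.
  exact: integrableZl.
have := integrable_fin_num measurableT il.
move=> /fineK lk; exists (fine (\int[ef_law F s]_z (ef_llr s t z)%:E)).
  by rewrite lk; apply: kl_div_density => //; exact: ef_law_change.
by apply: (kl_le_density il (esym lk)); exact: ef_law_change.
Qed.

End exp_family.

(** * Upper limits and sums of inverses in the extended reals *)

Lemma limn_esup_lt (R : realType) (u : (\bar R)^nat) (a : \bar R) :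
  limn_esup u < a -> \forall n \near \oo, u n < a.
Proof.
move=> /ereal_inf_lt[_ /= [V nV <-]] Va; apply: filterS nV => n Vn.
by apply: le_lt_trans Va; apply: ereal_sup_ubound; exists n.
Qed.

(* Trades the terms [0^-1 = +oo], i.e. the arms of zero divergence, for finite
   weights. *)
Lemma sum_inve_lt (R : realType) (J : finType) (b : J -> R) (x : R) :
  (forall j, 0 <= b j)%R -> x%:E < \sum_j (b j)%:E^-1 ->
  exists y : J -> R, [/\ forall j, (0 <= y j)%R,
    forall j, (b j * y j <= 1)%R & (x < \sum_j y j)%R].
Proof.
move=> b0 xb; have [[j bj0]|bN0] := pselect (exists j, b j = 0%R).
  (* As [b j = 0], the weight of [j] is unconstrained and can exceed [x] alone. *)
  exists (fun i => if i == j then `|x| + 1 else 0)%R; split => [i|i|].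
  - by case: ifP => // _; rewrite addr_ge0.
  - by case: eqVneq => [->|_]; rewrite ?bj0 ?mul0r ?mulr0.
  - rewrite -big_mkcond /= big_pred1_eq (le_lt_trans (ler_norm x))//.
    by rewrite ltrDl.
have {}bN0 j : b j != 0%R by apply/eqP => bj0; apply: bN0; exists j.
exists (fun j => (b j)^-1)%R; split => [j|j|].
- by rewrite invr_ge0.
- by rewrite divff.
- rewrite -lte_fin -sumEFin.
  by move: xb; under eq_bigr do rewrite inver (negbTE (bN0 _)).
Qed.

(** * Error probabilities and difficulty ratios at a fixed horizon *)

Section task.
Context (R : realType) (K : nat) (fam : 'I_K -> exp_family R)
  (task : id_task fam) (T : nat).
Variable A : algorithm R K (task_answer task) T.

Lemma measurable_error (mu : 'rV[R]_K) :
  measurable [set w | alg_answer A w <> task_ans task mu].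
Proof.
exact: measurableC (alg_answer_measurable A (task_ans task mu)).
Qed.

Lemma error_prob_ge0 mu : 0 <= error_prob A mu.
Proof. exact: measure_ge0. Qed.

Lemma error_prob_le1 mu : error_prob A mu <= 1.
Proof. by apply: probability_le1; exact: measurable_error. Qed.

Lemma error_prob_fin_num mu : error_prob A mu \is a fin_num.
Proof.
rewrite ge0_fin_numE ?error_prob_ge0//.
by rewrite (le_lt_trans (error_prob_le1 _))// ltry.
Qed.

Lemma difficulty_ratio_ge0 (H : 'rV[R]_K -> R) (mu : 'rV[R]_K) :
  (0 < H mu)%R -> 0 <= difficulty_ratio H A mu.
Proof.
move=> H0; rewrite /difficulty_ratio mule_ge0 ?lee_fin// inve_ge0.
apply: mule_ge0; first by rewrite lee_fin ltW.
by rewrite lne_ge0 inve_ge1 ?error_prob_ge0// error_prob_le1.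
Qed.

Lemma difficulty_ratio_lt (H : 'rV[R]_K -> R) (mu : 'rV[R]_K) (s : R) :
  (0 < H mu)%R -> (0 < s)%R -> difficulty_ratio H A mu < s%:E ->
  (expR (T%:R / (H mu * s)))%:E * error_prob A mu <= 1.
Proof.
move=> H0 s0; rewrite /difficulty_ratio.
have := error_prob_fin_num mu; have := error_prob_le1 mu.
have := error_prob_ge0 mu; move: (error_prob A mu) => [p| |]//.
rewrite lee_fin => p0; rewrite lee_fin => p1 _.
have [p_eq0|pN0] := eqVneq p 0%R; first by rewrite p_eq0 mule0.
have {p0}p_gt0 : (0 < p)%R by rewrite lt_neqAle eq_sym pN0.
rewrite inver (negbTE pN0) lne_EFin ?invr_gt0// -EFinM inver.
have [Hp0|HpN0] := eqVneq (H mu * ln p^-1)%R 0%R.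
  (* A zero denominator makes the ratio [+oo], against the hypothesis, except at [T = 0], where the
     claim is just [p <= 1]. *)
  case: T => [_|t]; first by rewrite mul0r expR0 mul1e lee_fin.
  by rewrite mulry gtr0_sg ?ltr0n// mul1e.
have ln_gt0 : (0 < ln p^-1)%R.
  rewrite lt_neqAle ln_ge0 ?invf_ge1// andbT eq_sym.
  by apply: contraNneq HpN0 => ->; rewrite mulr0.
rewrite -EFinM lte_fin ltr_pdivrMr ?mulr_gt0// => Ts.
rewrite -EFinM lee_fin -ler_pdivlMr// mul1r -[leRHS]lnK ?posrE ?invr_gt0//.
rewrite ler_expR ler_pdivrMr ?mulr_gt0//; apply/ltW/(lt_le_trans Ts).
by rewrite le_eqVlt; apply/orP; left; apply/eqP; ring.
Qed.

Lemma expected_pulls_ge0 nu j : (0 <= expected_pulls A nu j)%R.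
Proof.
by apply: sumr_ge0 => s _; apply/fine_ge0/integral_ge0 => w _; rewrite lee_fin.
Qed.

(** The answer that is correct for [mu] is an error for [lambda], so the event of returning it has
    probability at most the error probability under [lambda], and [kl_le_event] applies to it. *)
Lemma error_prob_change (mu lambda : 'rV[R]_K) (j : 'I_K) (k x : R) :
  task_ans task lambda <> task_ans task mu ->
  (forall i, i <> j -> lambda ord0 i = mu ord0 i) ->
  kl_le (bandit fam mu j) (bandit fam lambda j) k -> (0 <= x)%R ->
  (expR x)%:E * error_prob A lambda <= 1 ->
  (x * (1 - fine (error_prob A mu)) <=
   k * expected_pulls A (bandit fam mu) j + ln 2)%R.
Proof.
move=> ans_neq coord klj x0 xlambda.
pose E := alg_answer A @^-1` [set task_ans task mu].
have mE : measurable E := alg_answer_measurable A (task_ans task mu).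
have kl_hist : kl_le (history_law A (bandit fam mu) T)
    (history_law A (bandit fam lambda) T)
    (k * expected_pulls A (bandit fam mu) j).
  apply: kl_le_one_arm => //; first exact: kl_le_ge0 klj.
  by move=> i /eqP ij; rewrite /bandit coord.
have -> : (1 - fine (error_prob A mu) =
    fine (history_law A (bandit fam mu) T E))%R.
  apply: EFin_inj; rewrite EFinB !fineK ?error_prob_fin_num ?fin_num_measure//.
  rewrite /error_prob (_ : [set w | _] = ~` E)// -probability_setC ?setCK//.
  exact: measurableC.
apply: (kl_le_event kl_hist mE x0).
apply: le_trans xlambda; apply: lee_pmul => //.
apply: le_measure; rewrite ?inE//; first exact: measurable_error.
by move=> w; rewrite /E /= => -> /esym.
Qed.

End task.

(** * Summation over the arms and passage to the limit *)

Lemma horizon_bound (R : realType) (K : nat) (fam : 'I_K -> exp_family R)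
    (task : id_task fam) (T : nat) (A : algorithm R K (task_answer task) T)
    (H : 'rV[R]_K -> R) (mu : 'rV[R]_K) (lambda : 'I_K -> 'rV[R]_K)
    (k y : 'I_K -> R) (s : R) :
  (forall j, task_ans task (lambda j) <> task_ans task mu) ->
  (forall j, 0 < H (lambda j))%R ->
  (forall j i, i <> j -> lambda j ord0 i = mu ord0 i) ->
  (forall j, kl_le (bandit fam mu j) (bandit fam (lambda j) j) (k j)) ->
  (forall j, 0 <= y j)%R -> (forall j, H (lambda j) * k j * y j <= 1)%R ->
  (0 < s)%R -> (forall j, difficulty_ratio H A (lambda j) < s%:E) ->
  (T%:R / s * (1 - fine (error_prob A mu)) * (\sum_j y j) <=
   T%:R + \sum_j (H (lambda j) * y j * ln 2))%R.
Proof.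
move=> ans_neq H0 coord kl y0 ky s0 ratio_lt.
rewrite mulr_sumr -[X in (_ <= X + _)%R](sum_expected_pulls A (bandit fam mu)).
rewrite -big_split /=; apply: ler_sum => j _.
have x0 : (0 <= T%:R / (H (lambda j) * s))%R.
  by rewrite divr_ge0// mulr_ge0// ltW.
have := error_prob_change (ans_neq j) (coord j) (kl j) x0
  (difficulty_ratio_lt (H0 j) s0 (ratio_lt j)).
(* The weight [y j] stands for the inverse of [H (lambda j) * k j]: after this scaling the pulls of
   arm [j] have coefficient at most 1, and the total number of pulls is [T]. *)
move=> /(ler_wpM2l (mulr_ge0 (ltW (H0 j)) (y0 j))).
have -> : (H (lambda j) * y j * (T%:R / (H (lambda j) * s) *
    (1 - fine (error_prob A mu))) =
    T%:R / s * (1 - fine (error_prob A mu)) * y j)%R.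
  by field; rewrite !gt_eqF.
move=> /le_trans; apply; rewrite mulrDr lerD2r.
rewrite [leLHS](_ : _ = H (lambda j) * k j * y j *
    expected_pulls A (bandit fam mu) j)%R; last by ring.
by rewrite ler_piMl// expected_pulls_ge0.
Qed.

Theorem corollary4 (R : realType) (K : nat) (K_gt0 : (0 < K)%N)
  (fam : 'I_K -> exp_family R) (task : id_task fam)
  (H : 'rV[R]_K -> R)
  (H_ge0 : forall nu, task_dom task nu -> (0 <= H nu)%R)
  (mu : 'rV[R]_K) (lambda : 'I_K -> 'rV[R]_K)
  (mu_dom : task_dom task mu)
  (lambda_dom : forall j, task_dom task (lambda j))
  (lambda_ans : forall j, task_ans task (lambda j) <> task_ans task mu)
  (H_lambda : forall j, (0 < H (lambda j))%R)
  (lambda_coord : forall j k, k <> j -> lambda j ord0 k = mu ord0 k)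
  (A : forall T, algorithm R K (task_answer task) T)
  (error_to0 : error_prob (A T) mu @[T --> \oo] --> 0) :
  \sum_(j < K) ((H (lambda j))%:E *
                ef_KL (fam j) (mu ord0 j) (lambda j ord0 j))^-1 <=
  ereal_sup [set difficulty_limsup H A (lambda j) | j in [set: 'I_K]].
Proof.
pose k j := fine (ef_KL (fam j) (mu ord0 j) (lambda j ord0 j)).
have klP j : ef_KL (fam j) (mu ord0 j) (lambda j ord0 j) = (k j)%:E /\
    kl_le (bandit fam mu j) (bandit fam (lambda j) j) (k j).
  have [r re klr] := ef_KLP (task_dom_sub mu_dom j)
    (task_dom_sub (lambda_dom j) j).
  by rewrite /k re.
under eq_bigr do rewrite (klP _).1 -EFinM.
set S := ereal_sup _; rewrite leNgt; apply/negP => S_lt.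
have S_ge j : difficulty_limsup H A (lambda j) <= S.
  by apply: ereal_sup_ubound; exists j.
(* An arm exists because [0 < K], and its ratios are nonnegative. *)
have S_ge0 : 0 <= S.
  rewrite leNgt; apply/negP => S_lt0.
  have [n _ /(_ n (leqnn n)) /=] :=
    limn_esup_lt (le_lt_trans (S_ge (Ordinal K_gt0)) S_lt0).
  by rewrite ltNge difficulty_ratio_ge0.
have : S \is a fin_num.
  by rewrite ge0_fin_numE// (lt_le_trans S_lt)// leey.
move=> /fineK; move: (fine S) => r rS.
move: S_lt S_ge0; rewrite -rS lee_fin => S_lt r_ge0.
have Hk_ge0 j : (0 <= H (lambda j) * k j)%R.
  by rewrite mulr_ge0 ?(kl_le_ge0 (klP j).2)// ltW.
have [y [y_ge0 ky y_gt]] := sum_inve_lt Hk_ge0 S_lt.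
set Y := (\sum_j y j)%R in y_gt.
pose C := (\sum_j (H (lambda j) * y j * ln 2))%R.
pose s := ((r + Y) / 2)%R.
have rs : (r < s)%R by rewrite /s; lra.
have sY : (s < Y)%R by rewrite /s; lra.
have s_gt0 : (0 < s)%R by exact: le_lt_trans rs.
have Y_gt0 : (0 < Y)%R by exact: lt_trans sY.
(* Chosen so that [(1 - e) * Y] is the midpoint of [s] and [Y], still above [s]. *)
pose e := ((Y - s) / (2 * Y))%R.
have e_gt0 : (0 < e)%R by rewrite divr_gt0 ?mulr_gt0 ?subr_gt0.
have ratio_near : \forall T \near \oo,
    forall j, difficulty_ratio H (A T) (lambda j) < s%:E.
  apply: filter_forall => j; apply: limn_esup_lt.
  by apply: le_lt_trans (S_ge j) _; rewrite -rS lte_fin.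
have error_near : \forall T \near \oo, (fine (error_prob (A T) mu) < e)%R.
  by move/fine_cvgP : error_to0 => [_ /cvgr_lt]; exact.
(* The final inequality [T * (Y + s) / (2 * s) <= T + C] amounts to [T * (Y - s) <= 2 * s * C],
   which fails beyond this threshold. *)
have T_near := nbhs_infty_gtr (2 * s * C / (Y - s)).
have [T _ /(_ T (leqnn T)) /= [ratio_lt [error_lt]]] :=
  filterI ratio_near (filterI error_near T_near).
rewrite ltr_pdivrMr ?subr_gt0// => T_gt.
have := horizon_bound lambda_ans H_lambda lambda_coord (fun j => (klP j).2)
  y_ge0 ky s_gt0 ratio_lt.
rewrite -/Y -/C => bound.
have : (T%:R / s * (1 - e) * Y <= T%:R + C)%R.
  apply: le_trans bound; apply: ler_wpM2r; first exact: ltW.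
  by apply: ler_wpM2l; [rewrite divr_ge0// ltW|rewrite lerD2l lerN2 ltW].
have -> : (T%:R / s * (1 - e) * Y = T%:R * (Y + s) / (2 * s))%R.
  by rewrite /e; field; rewrite !gt_eqF.
have s2_gt0 : (0 < 2 * s)%R by lra.
rewrite ler_pdivrMr//; lra.
Qed.
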